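(* Let $\tau>0$. The robust satisficing problem $$\inf_{(q,m)\in\mathcal M,\ k>0} k\quad\text{s.t.}\quad \tau-\mathbb E_P[m(\tilde v)]\le k\,d(P,P_0)\quad\forall P\in\mathcal P$$ is equivalent to the problem $$\inf_{k>0} k\quad\text{s.t.}\quad \tau\le\min_{\pi\in[0,\Pi_0]}\left[\pi+k\cdot d(\pi)\right],$$ i.e., a number $k>0$ is feasible for the first problem (together with some $(q,m)\in\mathcal M$) if and only if it is feasible for the second, so both problems have the same optimal value.
   Context: $\mathcal P$ is the set of all probability distributions supported on $[0,1]$; $\bar P(x)=1-P(x)$ is the complementary CDF. $P_0\in\mathcal P$ is a fixed reference distribution. $\tilde v\sim P$ under $\mathbb E_P$. The type-1 Wasserstein distance is $d(P,P_0)=\int_0^1|\bar P(x)-\bar P_0(x)|\,\mathrm dx$. The set of direct mechanisms is $$\mathcal M=\left\{(q,m):[0,1]\to[0,1]\times\mathbb R\ :\ q \text{ non-decreasing},\ m(v)=\int_0^v x\,\mathrm dq(x)\ \forall v\in[0,1]\right\},$$ where the (Riemann–Stieltjes) integral equals $v q(v)-\int_0^v q(x)\,\mathrm dx$. For $\pi\ge0$, $d(\pi):=\int_0^1\left(\bar P_0(x)-\pi/x\right)^+\mathrm dx$, with $y^+=\max\{y,0\}$. $\Pi_0:=\max_{x\in[0,1]}\mathcal R_{P_0}(x)$, where $\mathcal R_{P_0}(x)=x\,\mathbb P_{P_0}(\tilde v\ge x)$. *)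

(* Defs.v *)
From HB Require Import structures.
From mathcomp Require Import all_boot all_order all_algebra.
From mathcomp Require Import all_classical all_reals all_analysis.
From mathcomp Require Import measurable_realfun ring lra.

Set Implicit Arguments.
Unset Strict Implicit.
Unset Printing Implicit Defensive.

Import Order.TTheory GRing.Theory Num.Theory.
Import numFieldNormedType.Exports.

Local Open Scope classical_set_scope.
Local Open Scope ring_scope.

(* [rs_integral f g a b I]: the Riemann-Stieltjes integral of f against g over
   [a, b] exists and equals I.  The partition is a :: s, with last point b; t i
   is the tag of its i-th interval. *)
Definition rs_integral (R : realType) (f g : R -> R) (a b I : R) : Prop :=
  forall e : R, 0 < e -> exists2 dl : R, 0 < dl &
    forall (s : seq R) (t : nat -> R), itv_partition a b s ->
    (forall i, (i < size s)%N ->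
       nth b (a :: s) i <= t i <= nth b (a :: s) i.+1 /\
       nth b (a :: s) i.+1 - nth b (a :: s) i < dl) ->
    `|\sum_(0 <= i < size s)
        f (t i) * (g (nth b (a :: s) i.+1) - g (nth b (a :: s) i)) - I| < e.

Section definitions.
Context {R : realType}.
Implicit Types (P Q : probability (measurableTypeR R) R) (q m : R -> R).

Definition unit_supported P : Prop := P `[0, 1]%classic = 1%E.

Definition tail P (x : R) : R := 1 - fine (P `]-oo, x]%classic).

Definition wasserstein1 P Q : R :=
  \int[lebesgue_measure]_(x in `[0, 1]) `|tail P x - tail Q x|.

(* Mechanisms are functions on [0, 1]: the values of q and m elsewhere are
   irrelevant.  By [rs_integral_idE], the third clause says that
   m v = v * q v - \int_0^v q. *)
Definition mechanism q m : Prop :=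
  [/\ forall v, v \in `[0, 1] -> q v \in `[0, 1],
      {in `[0, 1] &, {homo q : x y / x <= y}} &
      forall v, v \in `[0, 1] -> rs_integral id q 0 v (m v)].

(* The expectation of m when P is supported on [0, 1]. *)
Definition expected_revenue P m : R := \int[P]_(v in `[0, 1]) m v.

Definition posted_revenue P (x : R) : R := x * fine (P `[x, +oo[%classic).

(* A maximum, by [max_revenue_attained]. *)
Definition max_revenue P : R := sup [set posted_revenue P x | x in `[0, 1]].

(* At x = 0 the convention pi / 0 = 0 applies; a single point does not matter. *)
Definition revenue_distance P (pi : R) : R :=
  \int[lebesgue_measure]_(x in `[0, 1]) Num.max (tail P x - pi / x) 0.

Definition satisficing_feasible P0 (tau : R) q m (k : R) : Prop :=
  forall P, unit_supported P ->
    tau - expected_revenue P m <= k * wasserstein1 P P0.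

Definition reduced_objective P0 (k pi : R) : R := pi + k * revenue_distance P0 pi.

(* The infimum is a minimum, by [reduced_objective_min]. *)
Definition reduced_feasible P0 (tau k : R) : Prop :=
  tau <= inf [set reduced_objective P0 k pi | pi in `[0, max_revenue P0]].

End definitions.

Section rs_identity.
Context {R : realType}.
Implicit Types (q : R -> R) (a b v x y : R).
Let mu := @lebesgue_measure R.

Lemma integrable_nd q a b : {in `[a, b] &, {homo q : x y / x <= y}} ->
  mu.-integrable `[a, b] (EFin \o q).
Proof.
move=> ndq; have [ba|ab] := ltP b a.
  by rewrite set_itv_ge ?bnd_simp -?ltNge//; exact: integrable_set0.
pose c x := Num.max a (Num.min b x).
have cab x : c x \in `[a, b].
  by rewrite in_itv/= /c le_max lexx ge_max ab/= ge_min lexx.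
have cE x : x \in `[a, b] -> c x = x.
  by rewrite in_itv/= /c => /andP[ax xb]; rewrite min_r// max_r.
apply: measurable_bounded_integrable => //=.
- by rewrite /mu lebesgue_measure_itv/=; case: ifP => _ //; rewrite -EFinB ltry.
- apply: (@eq_measurable_fun _ _ _ _ _ (q \o c)).
    by move=> x; rewrite inE => xab /=; rewrite cE.
  apply: nondecreasing_measurable => // x y xy /=; apply: ndq => //.
  rewrite /c; set u := Num.min b x; set w := Num.min b y.
  have uw : u <= w.
    by rewrite /u /w; case: (leP b x) => ?; case: (leP b y) => ? //; lra.
  by case: (leP a u) => ?; case: (leP a w) => ?; lra.
- exists (`|q a| + `|q b|); split; first by rewrite realE addr_ge0.
  move=> M qM x /= xab; apply: (le_trans _ (ltW qM)).
  move: (xab); rewrite in_itv/= => /andP[ax xb].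
  have qax : q a <= q x by apply: ndq; rewrite ?in_itv/= ?lexx ?ab ?ax ?xb.
  have qxb : q x <= q b by apply: ndq; rewrite ?in_itv/= ?lexx ?ab ?ax ?xb.
  have := ler_norm (q b); have := ler_norm (- q a); rewrite normrN => h1 h2.
  have := normr_ge0 (q a); have := normr_ge0 (q b); rewrite ler_norml; lra.
Qed.

Lemma Rintegral_nd_bounds q a b : a <= b ->
  {in `[a, b] &, {homo q : x y / x <= y}} ->
  q a * (b - a) <= \int[mu]_(x in `[a, b]) q x <= q b * (b - a).
Proof.
move=> ab ndq.
have ba c : c * (b - a) = \int[mu]_(x in `[a, b]) c.
  rewrite Rintegral_cst//= lebesgue_measure_itv/= lte_fin.
  by case: ltgtP ab => [//||->]//; rewrite subrr.
have ic c : mu.-integrable `[a, b] (EFin \o (fun=> c)) by exact: integrable_nd.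
rewrite !ba; apply/andP; split; apply: le_Rintegral => //=;
  try exact: integrable_nd; move=> x; rewrite in_itv/= => /andP[ax xb];
  by apply: ndq; rewrite ?in_itv/= ?lexx ?ab ?ax ?xb.
Qed.

Let G q v := v * q v - \int[mu]_(x in `[0, v]) q x.

Let G_step q v x y t : {in `[0, v] &, {homo q : x y / x <= y}} ->
  0 <= x -> x <= t <= y -> y <= v ->
  `|t * (q y - q x) - (G q y - G q x)| <= (y - x) * (q y - q x).
Proof.
move=> ndq x0 /andP[xt ty] yv.
have subd c d : 0 <= c -> d <= v -> {in `[c, d] &, {homo q : x y / x <= y}}.
  move=> c0 dv a b; rewrite !in_itv/= => ? ?; apply: ndq; rewrite in_itv/=; lra.
have xy : x <= y by lra.
have qxy : q x <= q y by apply: ndq; rewrite ?in_itv/=; lra.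
have /andP[lo hi] := Rintegral_nd_bounds xy (subd _ _ x0 yv).
have I0y : mu.-integrable `[0, y] (EFin \o q) by apply: integrable_nd; exact: subd.
have := @Rintegral_itvB R q (BLeft 0) (BRight y) x I0y.
rewrite !bnd_simp => /(_ x0 xy) E.
have E2 : \int[mu]_(u in `]x, y]) q u = \int[mu]_(u in `[x, y]) q u.
  apply: Rintegral_itv_obnd_cbnd; apply: (integrableS _ _ _ I0y) => //.
  by apply: subset_itvr; rewrite bnd_simp.
rewrite /G ler_norml; rewrite E2 in E; nra.
Qed.

Lemma rs_integral_idE q v I : 0 <= v -> {in `[0, v] &, {homo q : x y / x <= y}} ->
  rs_integral id q 0 v I <-> I = v * q v - \int[mu]_(x in `[0, v]) q x.
Proof.
move=> v0 ndq; rewrite -/(G q v).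
have q0v : q 0 <= q v by apply: ndq; rewrite ?in_itv/= ?lexx ?v0.
have G0 : G q 0 = 0.
  by rewrite /G mul0r set_itv1 Rintegral_set1 subrr.
have rsG : rs_integral id q 0 v (G q v).
  move=> e e0; pose D := q v - q 0 + 1.
  have D0 : 0 < D by rewrite /D; lra.
  exists (e / D); first by rewrite divr_gt0.
  move=> s t ps ts; set x := nth v (0 :: s).
  have xs : x (size s) = v by exact: itv_partition_nth_size ps.
  have x0 : x 0%N = 0 by [].
  have -> : G q v = \sum_(0 <= i < size s) (G q (x i.+1) - G q (x i)).
    by rewrite telescope_sumr// xs x0 G0 subr0.
  rewrite -sumrB; apply: le_lt_trans (ler_norm_sum _ _ _) _.
  apply: (@le_lt_trans _ _ (e / D * (q v - q 0))); last first.
    rewrite -mulrA -[ltRHS]mulr1 ltr_pM2l//.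
    by rewrite mulrC ltr_pdivrMr// mul1r /D; lra.
  have -> : q v - q 0 = \sum_(0 <= i < size s) (q (x i.+1) - q (x i)).
    by rewrite (telescope_sumr (fun i => q (x i)))// xs x0.
  rewrite mulr_sumr; apply: ler_sum_nat => i /andP[_ ilts].
  have [ti mi] := ts _ ilts.
  have xi0 : 0 <= x i by apply: itv_partition_nth_ge ps; rewrite ltnS ltnW.
  have xiv : x i.+1 <= v by apply: itv_partition_nth_le ps.
  apply: le_trans (G_step ndq xi0 ti xiv) _.
  rewrite ler_wpM2r//; last exact: ltW.
  rewrite subr_ge0; move: ti => /andP[t1 t2]; have ? := le_trans t1 t2.
  apply: ndq => //; rewrite in_itv/= ?xi0 ?xiv ?andbT/=.
    exact: le_trans xiv.
  exact: le_trans xi0 _.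
split=> [rsI|->//]; apply/eqP/contraT => neq.
pose e := `|I - G q v| / 2.
have e0 : 0 < e by rewrite divr_gt0// normr_gt0 subr_eq0.
have [d1 d10 H1] := rsI _ e0; have [d2 d20 H2] := rsG _ e0.
suff [s [ps ms]] : exists s, itv_partition 0 v s /\ forall i, (i < size s)%N ->
    nth v (0 :: s) i <= nth v (0 :: s) i.+1 /\
    nth v (0 :: s) i.+1 - nth v (0 :: s) i < Num.min d1 d2.
  have {}H1 := H1 s (nth v (0 :: s)) ps; have {}H2 := H2 s (nth v (0 :: s)) ps.
  move: H1 H2; set S := \sum_(_ <= _ < _) _ => H1 H2.
  have {}H1 : `|S - I| < e.
    by apply: H1 => i /ms[->]; rewrite lexx lt_min => /andP[].
  have {}H2 : `|S - G q v| < e.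
    by apply: H2 => i /ms[->]; rewrite lexx lt_min => /andP[].
  have := ler_distD S I (G q v); rewrite (distrC I S).
  have -> : `|I - G q v| = e + e by rewrite -splitr.
  by rewrite leNgt ltrD.
case: (ltgtP v 0) v0 => // [v0 _|-> _]; last by exists [::].
pose dl := Num.min d1 d2.
have dl0 : 0 < dl by rewrite lt_min d10.
pose n := Num.truncn (v / dl); pose h := v / n.+1%:R.
have h0 : 0 < h by rewrite divr_gt0.
have hdl : h < dl.
  by rewrite ltr_pdivrMr// mulrC -ltr_pdivrMr// truncnS_gt.
pose f i : R := i%:R * h.
have sE : 0 :: map f (iota 1 n.+1) = map f (iota 0 n.+2).
  by rewrite /= /f !mul0r.
have fn i : (i < n.+2)%N -> nth v (map f (iota 0 n.+2)) i = f i.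
  by move=> ilt; rewrite (nth_map 0%N) ?size_iota// nth_iota.
exists (map f (iota 1 n.+1)); split.
  split; last first.
    rewrite (last_nth v) size_map size_iota sE fn// /f /h mulrC divfK//.
  have -> : 0 = f 0%N by rewrite /f mul0r.
  rewrite path_map; apply: (@sub_path _ ltn); last exact: (iota_ltn_sorted 0 n.+2).
  by move=> i j /= ij; rewrite ltr_pM2r// ltr_nat.
move=> i; rewrite size_map size_iota sE => ilt.
rewrite !fn//; last exact: ltnW.
rewrite -/dl /f -mulrBl -natrB// subSnn mul1r; split => //.
by rewrite ler_pM2r// ler_nat.
Qed.

End rs_identity.

Section attainment.
Context {R : realType} (P : probability (measurableTypeR R) R).
Let mu := @lebesgue_measure R.

Let F (x : R) := fine (P `[x, +oo[%classic).

Let F_ni : {homo F : x y / x <= y >-> y <= x}.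
Proof.
move=> x y xy; rewrite /F fine_le ?fin_num_measure// le_measure ?inE//.
by apply: subset_itvr; rewrite bnd_simp.
Qed.

Let F01 x : 0 <= F x <= 1.
Proof.
rewrite /F fine_ge0//= -[leRHS]/(fine 1%E) fine_le ?fin_num_measure//.
exact: probability_le1.
Qed.

Let F_left (p e : R) : 0 < e -> exists2 d : R, 0 < d < e & F (p - d) < F p + e.
Proof.
move=> e0; pose A n := `[p - n.+1%:R^-1, +oo[%classic : set (measurableTypeR R).
have bigA : \bigcap_n A n = `[p, +oo[%classic.
  apply/seteqP; split=> x /=; last first.
    rewrite /A in_itv/= andbT => px n _ /=; rewrite in_itv/= andbT.
    by rewrite (le_trans _ px)// gerBl.
  move=> Ax; rewrite in_itv/= andbT leNgt; apply/negP => xp.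
  have /ltr_add_invr[n] := xp; have := Ax n I; rewrite /A/= in_itv/= andbT.
  by rewrite lerBlDr => h1 h2; have := le_lt_trans h1 h2; rewrite ltxx.
have : (fine \o (P \o A)) n @[n --> \oo] --> F p.
  apply: fine_cvg; rewrite fineK ?fin_num_measure//.
  rewrite -bigA; apply: nonincreasing_cvg_mu => //=.
  - by rewrite -ge0_fin_numE// fin_num_measure//; exact: measurable_itv.
  - by move=> n; exact: measurable_itv.
  - by rewrite bigA; exact: measurable_itv.
  - move=> n k nk; apply/subsetPset; apply: subset_itvr.
    by rewrite bnd_simp lerB// lef_pV2 ?posrE// ler_nat.
move=> /cvgrPdist_lt /(_ _ e0) H.
near \oo => n.
exists n.+1%:R^-1.
  by rewrite invr_gt0 ltr0n/=; near: n; exact: (near_infty_natSinv_lt (PosNum e0)).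
have : `|F p - F (p - n.+1%:R^-1)| < e by near: n.
by rewrite ltr_norml; lra.
Unshelve. all: by end_near. Qed.

Let posted_revenue_ub : ubound [set posted_revenue P x | x in `[0, 1]] 1.
Proof.
move=> _ /= [x + <-]; rewrite in_itv/= => /andP[x0 x1].
have /andP[? ?] := F01 x; rewrite /posted_revenue -/(F x); nra.
Qed.

Let posted_revenue_has_sup : has_sup [set posted_revenue P x | x in `[0, 1]].
Proof.
split; last by exists 1.
by exists (posted_revenue P 0); exists 0; rewrite //= in_itv/= lexx ler01.
Qed.

Lemma posted_revenue_le_max x : x \in `[0, 1] ->
  posted_revenue P x <= max_revenue P.
Proof.
by move=> x01; apply: ub_le_sup; [exists 1 | exists x].
Qed.

Lemma max_revenue_ge0 : 0 <= max_revenue P.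
Proof.
have := @posted_revenue_le_max 0; rewrite /posted_revenue mul0r; apply.
by rewrite in_itv/= lexx ler01.
Qed.

Lemma max_revenue_attained :
  exists2 x, x \in `[0, 1] & posted_revenue P x = max_revenue P.
Proof.
have adh n : exists x : R, x \in `[0, 1] /\
    max_revenue P - n.+1%:R^-1 < posted_revenue P x.
  have n0 : 0 < n.+1%:R^-1 :> R by rewrite invr_gt0.
  have [_ [x x01 <-] lt] := sup_adherent n0 posted_revenue_has_sup.
  by exists x; split.
have [u /all_and2[u01 ulim]] := choice adh.
have [|p [p01 cl]] := @segment_compact R 0 1 (u @ \oo) _.
  by exists 0%N => // n _; exact: u01.
exists p => //; apply/eqP; rewrite eq_le posted_revenue_le_max//=.
apply/ler_addgt0Pr => e e0; have e30 : 0 < e / 3 :> R by rewrite divr_gt0.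
have [d /andP[d0 de] Fd] := F_left p e30.
have [y [[n [ny un]] yp]] : exists y : R, (exists n, n.+1%:R^-1 < e / 3 /\ y = u n) /\
    `|p - y| < d.
  have [//||y [[n nlt yE] yb]] := cl
    [set y | exists2 n, n.+1%:R^-1 < e / 3 & y = u n] (ball p d).
  - have [N _ HN] := near_infty_natSinv_lt (PosNum e30).
    by exists N => // n /= Nn; exists n => //; exact: HN.
  - exact: nbhsx_ballx.
  - by exists y; split => //; exists n.
move: (u01 n) (ulim n); rewrite -un in_itv/= => /andP[y0 y1] ly.
move: p01 yp; rewrite /= in_itv/= ltr_norml => /andP[p0 p1] /andP[? ?].
have Fy : F y <= F (p - d) by apply: F_ni; lra.
have /andP[? ?] := F01 p; move: ly; rewrite /posted_revenue -/(F y) -/(F p) => ly.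
have a1 : y * F y <= y * (F p + e / 3) by rewrite ler_wpM2l//; lra.
have a2 : y * F p <= (p + d) * F p by rewrite ler_wpM2r//; lra.
have a3 : d * F p <= d * 1 by rewrite ler_wpM2l//; lra.
have a4 : y * (e / 3) <= 1 * (e / 3) by rewrite ler_wpM2r//; lra.
rewrite mulrDr in a1; rewrite mulrDl in a2; rewrite mulr1 in a3; rewrite mul1r in a4.
have eE : e = e / 3 + e / 3 + e / 3 :> R by field.
set w := e / 3 in a1 a4 de ny eE; clearbody w; rewrite eE.
set yw := y * w in a1 a4; set pF := p * F p in a2 *; set dF := d * F p in a2 a3.
set yp := y * F p in a1 a2; set yy := y * F y in a1 ly; set nn := _^-1 in ny ly.
have : max_revenue P < nn + yy by rewrite -ltrBlDl.
lra.
Qed.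

Let tail01 x : 0 <= tail P x <= 1.
Proof.
rewrite /tail subr_ge0 gerBl fine_ge0// andbT.
by rewrite -[leRHS]/(fine 1%E) fine_le ?fin_num_measure// probability_le1.
Qed.

Let measurable_tail D : measurable D -> measurable_fun D (tail P).
Proof.
move=> mD; apply: nonincreasing_measurable => // x y xy.
rewrite /tail lerB// fine_le ?fin_num_measure// le_measure ?inE//.
by apply: subset_itvl; rewrite bnd_simp.
Qed.

Let f (l x : R) := Num.max (tail P x - `|l| / x) 0.

Let f01 l x : x \in `[0, 1] -> `|f l x| <= 1.
Proof.
rewrite in_itv/= => /andP[x0 x1]; rewrite /f ger0_norm ?le_max ?lexx ?orbT//.
rewrite ge_max ler01 andbT; have /andP[_ t1] := tail01 x.
by rewrite (le_trans _ t1)// gerBl divr_ge0.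
Qed.

Let mf l : measurable_fun (`[0, 1]%classic : set R) (f l).
Proof.
apply: measurable_maxr => //; apply: measurable_funB; first exact: measurable_tail.
apply: measurable_funM => //.
rewrite -(@setU1itv _ R (BRight 1) 0 false) ?bnd_simp//.
apply/measurable_funU => //; split; first exact: measurable_fun_set1.
apply: subspace_continuous_measurable_fun => //.
apply: continuous_in_subspaceT => x; rewrite inE/= in_itv/= => /andP[x0 _].
by apply: inv_continuous; rewrite gt_eqF.
Qed.

Let intf l : mu.-integrable `[0, 1] (EFin \o f l).
Proof.
apply: measurable_bounded_integrable => //=.
  by rewrite /mu lebesgue_measure_itv/= lte01 -EFinB ltry.
  exact: mf.
exists 1; split=> // M M1 x /= x01; exact: le_trans (f01 l x01) (ltW M1).
Qed.

Let revenue_distanceE pi : 0 <= pi ->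
  revenue_distance P pi = \int[mu]_(x in `[0, 1]) f pi x.
Proof.
by move=> pi0; apply: eq_Rintegral => x _; rewrite /f ger0_norm.
Qed.

Lemma reduced_objective_min (k : R) :
  exists2 pi, pi \in `[0, max_revenue P] &
    reduced_objective P k pi =
      inf [set reduced_objective P k pi | pi in `[0, max_revenue P]] /\
    forall pi', pi' \in `[0, max_revenue P] ->
      reduced_objective P k pi <= reduced_objective P k pi'.
Proof.
have m0 := max_revenue_ge0; set M := max_revenue P in m0 *.
pose g l := l + k * \int[mu]_(x in `[0, 1]) f l x.
have gE l : l \in `[0, M] -> reduced_objective P k l = g l.
  by rewrite in_itv/= => /andP[l0 _]; rewrite /reduced_objective revenue_distanceE.
have cf : {in (`]- 1, M + 1[%classic : set R),
    continuous (fun l => \int[mu]_(x in `[0, 1]) f l x)}.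
  apply: (@continuity_under_integral _ _ _ _ _ _ _ _ _ _ _ (cst 1)) => //.
  - apply: aeW => x _ l _; rewrite /f.
    apply: (@continuous_max R R (fun l => tail P x - `|l| / x) (cst 0) l).
      apply: cvgB; first exact: cvg_cst.
      by apply: cvgM; [exact: norm_continuous|exact: cvg_cst].
    exact: cvg_cst.
  - by apply: integrable_nd => x y _ _ _; exact: lexx.
  - by move=> l _; apply: aeW => x; exact: f01.
have [|c c0M cmin] := @EVT_min R g 0 M m0.
  apply: continuous_in_subspaceT => l; rewrite inE/= in_itv/= => /andP[l0 lM].
  apply: cvgD; first exact: cvg_id.
  apply: cvgM; first exact: cvg_cst.
  by apply: cf; rewrite inE/= in_itv/=; lra.
exists c => //; split; last by move=> l lM; rewrite !gE//; exact: cmin.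
apply/eqP; rewrite eq_le; apply/andP; split.
  apply: lb_le_inf; first by exists (reduced_objective P k c); exists c.
  by move=> _ [l lM <-]; rewrite !gE//; exact: cmin.
apply: ge_inf; last by exists c.
by exists (reduced_objective P k c) => _ [l lM <-]; rewrite !gE//; exact: cmin.
Qed.

End attainment.

(* Main.v *)
From HB Require Import structures.
Require Import Defs.
From mathcomp Require Import all_boot all_order all_algebra.
From mathcomp Require Import all_classical all_reals all_analysis.
From mathcomp Require Import measurable_realfun ring lra.

Set Implicit Arguments.
Unset Strict Implicit.
Unset Printing Implicit Defensive.

Import Order.TTheory GRing.Theory Num.Theory.
Import numFieldNormedType.Exports.

Local Open Scope classical_set_scope.
Local Open Scope ring_scope.

(** Fix k > 0.  Facing a mechanism with allocation q, an adversary chooses a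
    law P so as to minimise E_P[m] + k * wasserstein1 P P0, and k is feasible
    when this value is at least tau.

    From a feasible mechanism to the reduced problem: E_P[m] is the integral
    of the posted-price revenues of P against dq, whose mass is at most 1, so
    E_P[m] <= pi as soon as no posted price earns more than pi under P
    ([expected_revenue_le]).  Capping the tail of P0 by pi / x yields such a
    law, at distance revenue_distance P0 pi from P0 ([exists_capped_law]).
    Hence tau <= pi + k * revenue_distance P0 pi for every pi.

    From the reduced problem to a mechanism, no minimax theorem is used: the
    optimal mechanism is read off the first-order condition at a minimiser p
    of pi + k * revenue_distance P0 pi.  This function is convex, with
    one-sided derivatives 1 - k * \int w x / x, where w is the indicator of
    tail P0 x > p / x on the right and of tail P0 x >= p / x on the left.  Some
    convex combination w of the two indicators therefore satisfies
    k * \int w x / x = 1 (or <= 1 if p = 0): this is [optimal_density].  Take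
    for dq the measure with density k * w x / x, so that the payment m has
    density k * w.  Then m is k-Lipschitz, because 0 <= w <= 1, and
    E_P[m] = k * \int w * tail P by Tonelli ([density_expected_revenue]), so
      E_P[m] + k * wasserstein1 P P0 >= k * \int w * tail P0
                                     = p + k * revenue_distance P0 p >= tau;
    the middle equality is complementary slackness, since w vanishes where
    tail P0 x < p / x and equals 1 where tail P0 x > p / x. *)

(** * Measurability and integrability *)

(** Only 0 escapes continuity, and a point is measurable. *)
Lemma measurable_inv (R : realType) (D : set (measurableTypeR R)) :
  measurable D -> measurable_fun D (GRing.inv : R -> R).
Proof.
move=> mD; apply: (measurable_funS measurableT) => //.
rewrite -(setvU [set (0 : R)]); apply/measurable_funU => //.
  exact: measurableC.
split; last exact: measurable_fun_set1.
apply: open_continuous_measurable_fun => [|x].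
  by rewrite openC; exact: closed_eq.
by rewrite inE/= => /eqP x0; exact: inv_continuous.
Qed.

Lemma bounded_integrable d (T : measurableType d) (R : realType)
    (nu : {measure set T -> \bar R}) (D : set T) (f : T -> R) (M : R) :
  measurable D -> (nu D < +oo)%E -> measurable_fun D f ->
  (forall x, D x -> `|f x| <= M) -> nu.-integrable D (EFin \o f).
Proof.
move=> mD nuD mf fM; apply: measurable_bounded_integrable => //.
exists M; split; first exact: num_real.
by move=> N MN x /= /fM /le_trans; apply; exact: ltW.
Qed.

Lemma lebesgue_unit_fin (R : realType) :
  (@lebesgue_measure R `[0%R, 1%R]%classic < +oo)%E.
Proof. by rewrite lebesgue_measure_itv/= lte01 -EFinB ltry. Qed.

Section integrable_EFin.
Context d (T : measurableType d) (R : realType).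
Variables (nu : {measure set T -> \bar R}) (D : set T).
Hypothesis mD : measurable D.
Implicit Types f g : T -> R.

Lemma integrable_EFinZl k f : nu.-integrable D (EFin \o f) ->
  nu.-integrable D (EFin \o (fun x => k * f x)).
Proof. by move=> fi; exact: (integrableZl mD k fi). Qed.

Lemma integrable_EFinD f g : nu.-integrable D (EFin \o f) ->
  nu.-integrable D (EFin \o g) ->
  nu.-integrable D (EFin \o (fun x => f x + g x)).
Proof. by move=> fi gi; exact: (integrableD mD fi gi). Qed.

End integrable_EFin.

(** * Tails of laws on the unit interval *)

Section tail.
Context {R : realType} (P : probability (measurableTypeR R) R).

Lemma tailE x : tail P x = fine (P `]x, +oo[%classic).
Proof.
rewrite /tail -setCitvl probability_setC//.
by rewrite fineB ?fin_num_measure.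
Qed.

Lemma tail_ge0 x : 0 <= tail P x. Proof. by rewrite tailE fine_ge0. Qed.

Lemma tail_le1 x : tail P x <= 1.
Proof. by rewrite /tail gerBl fine_ge0. Qed.

Lemma tail_ni x y : x <= y -> tail P y <= tail P x.
Proof.
move=> xy; rewrite /tail lerB// fine_le ?fin_num_measure//.
by rewrite le_measure ?inE//; apply: subset_itvl; rewrite bnd_simp.
Qed.

Lemma measurable_tail D : measurable D -> measurable_fun D (tail P).
Proof.
by move=> mD; apply: nonincreasing_measurable => // x y; exact: tail_ni.
Qed.

Let idTR : measurableTypeR R -> R := idfun.

#[local] HB.instance Definition _ :=
  @isMeasurableFun.Build _ _ _ _ idTR (@measurable_id _ _ setT).

Lemma tail_right_continuous : right_continuous (tail P).
Proof.
move=> x; rewrite /tail; apply: cvgB; first exact: cvg_cst.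
apply: fine_cvg; rewrite fineK ?fin_num_measure//.
exact: (@cdf_right_continuous _ _ _ P (idTR : {RV P >-> R})).
Qed.

(** The tail counts the values strictly above x, a posted price x also sells at
    the value x itself. *)
Lemma tail_le_posted x : 0 <= x -> x * tail P x <= posted_revenue P x.
Proof.
move=> x0; rewrite tailE /posted_revenue ler_wpM2l// fine_le ?fin_num_measure//.
by rewrite le_measure ?inE//; apply: subset_itvr; rewrite bnd_simp.
Qed.

Hypothesis P01 : unit_supported P.

Lemma unit_supported_null (A : set (measurableTypeR R)) :
  measurable A -> A `<=` ~` `[0, 1]%classic -> P A = 0%E.
Proof.
move=> mA A01; apply/eqP; rewrite eq_le measure_ge0 andbT.
have <- : P (~` `[0, 1]%classic) = 0%E.
  by rewrite probability_setC// [X in (_ - X)%E]P01 subee.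
by rewrite le_measure ?inE//; exact: measurableC.
Qed.

Lemma tail_lt0 x : x < 0 -> tail P x = 1.
Proof.
move=> x0; rewrite /tail unit_supported_null ?subr0// => y /=.
by rewrite !in_itv/= => yx; lra.
Qed.

Lemma tail_ge1 x : 1 <= x -> tail P x = 0.
Proof.
move=> x0; rewrite tailE unit_supported_null// => y /=.
by rewrite !in_itv/= andbT => yx; lra.
Qed.

End tail.

(** * Capping the revenue of a law *)

Section probability_of_cdf.
Context {R : realType} (F : R -> R).
Hypothesis F_nd : {homo F : x y / x <= y}.
Hypothesis F_rc : right_continuous F.
Hypothesis F_lt0 : forall x, x < 0 -> F x = 0.
Hypothesis F_ge1 : forall x, 1 <= x -> F x = 1.

Let F_Ny : F @ -oo --> (0 : R).
Proof.
apply: cvg_near_cst; near=> x; apply: F_lt0; near: x.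
exact: nbhs_ninfty_lt.
Unshelve. all: by end_near. Qed.

Let F_y : F @ +oo --> (1 : R).
Proof.
apply: cvg_near_cst; near=> x; apply: F_ge1; near: x.
exact: nbhs_pinfty_ge.
Unshelve. all: by end_near. Qed.

#[local] HB.instance Definition _ := isCumulative.Build R _ R F F_nd F_rc.
#[local] HB.instance Definition _ :=
  isCumulativeBounded.Build R 0 1 F F_Ny F_y.

(** The law is the Lebesgue-Stieltjes measure of F; it has no mass on the
    negative half-line because F vanishes up to -1/(n+1) for every n. *)
Lemma probability_of_cdf : exists2 P : probability (measurableTypeR R) R,
  unit_supported P & forall x, tail P x = 1 - F x.
Proof.
pose P : probability (measurableTypeR R) R := lebesgue_stieltjes_measure F.
have PF x : P `]-oo, x]%classic = (F x)%:E.
  exact: cdf_lebesgue_stieltjes_id.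
exists P; last by move=> x; rewrite /tail PF.
have neg : P `]-oo, 0[%classic = 0%E.
  pose I n : set (measurableTypeR R) := `]-oo, - n.+1%:R^-1]%classic.
  have mI n : measurable (I n) by exact: measurable_itv.
  have -> : `]-oo, 0[%classic = \bigcup_n I n.
    apply/seteqP; split => x /=.
      rewrite in_itv/= -oppr_gt0 => /ltr_add_invr[n]; rewrite add0r => nx.
      by exists n => //=; rewrite /I/= in_itv/= lerNr ltW.
    case=> n _; rewrite /I/= !in_itv/= => /le_lt_trans; apply.
    by rewrite oppr_lt0.
  apply/eqP; rewrite eq_le measure_ge0 andbT.
  apply: (@le_trans _ _ (\sum_(0 <= n <oo) P (I n))%E).
    by apply: measure_sigma_subadditive => //; apply: bigcup_measurable.
  by rewrite eseries0// => n _ _; rewrite PF F_lt0// oppr_lt0.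
have : P `]-oo, 1]%classic = 1%E by rewrite PF F_ge1.
rewrite (@itv_bndbnd_setU _ _ _ (BLeft 0)) ?bnd_simp// measureU//.
  by rewrite [X in (X + _)%E]neg add0e.
by apply/seteqP; split => x //=; rewrite !in_itv/=; lra.
Qed.

End probability_of_cdf.

Section capped_law.
Context {R : realType} (P0 : probability (measurableTypeR R) R).
Hypothesis P0_01 : unit_supported P0.

(** The witness has tail min (tail P0 x) (pi / x), which makes it the closest
    law to P0 among those of revenue at most pi.  The distance bound is an
    inequality only to absorb the point x = 0, where pi / x takes the value 0. *)
Lemma exists_capped_law (pi : R) : 0 <= pi ->
  exists2 P : probability (measurableTypeR R) R, unit_supported P &
    forall x, x \in `[0, 1] -> x * tail P x <= pi /\
      `|tail P x - tail P0 x| <= Num.max (tail P0 x - pi / x) 0.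
Proof.
rewrite le_eqVlt => /predU1P[<-|pi0].
  (* A zero revenue level forces all the mass to sit at 0. *)
  exists (dirac (0 : measurableTypeR R)) => [|x].
    by rewrite /unit_supported /= diracE mem_set//= in_itv/= lexx ler01.
  rewrite in_itv/= => /andP[x0 x1].
  have -> : tail (dirac (0 : measurableTypeR R)) x = 0.
    by rewrite /tail /= indicE mem_set ?subrr//= in_itv/=.
  by rewrite mulr0 mul0r subr0 sub0r normrN ger0_norm ?tail_ge0// le_max lexx.
(* Equal to pi / x for x >= pi, and to 1, where the cap is void, for x <= pi:
   this keeps the cap continuous at 0, which pi / x is not. *)
pose c x := pi / Num.max x pi.
have m0 x : 0 < Num.max x pi by rewrite lt_max pi0 orbT.
have c_ni x y : x <= y -> c y <= c x.
  move=> xy; rewrite /c ler_pM2l// lef_pV2 ?posrE// ge_max !le_max lexx xy/=.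
  by rewrite orbT.
have [|x|x x0|x x1|P PP PE] :=
    @probability_of_cdf R (fun x => 1 - Num.min (tail P0 x) (c x)).
- move=> x y xy; rewrite lerB// le_min !ge_min.
  by rewrite tail_ni//= c_ni// orbT.
- apply: cvgB; first exact: cvg_cst.
  under eq_fun do rewrite Num.Theory.minr_absE.
  rewrite Num.Theory.minr_absE; apply: cvgM; last exact: cvg_cst.
  have ct : tail P0 y @[y --> x^'+] --> tail P0 x.
    exact: tail_right_continuous.
  have cc : c y @[y --> x^'+] --> c x.
    apply: cvgM; first exact: cvg_cst.
    apply: cvgV; first exact: lt0r_neq0.
    have mE y : Num.max y pi = (y + pi + `|y - pi|) / 2 by exact: maxr_absE.
    under eq_fun do rewrite mE.
    rewrite mE; apply: cvgM; last exact: cvg_cst.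
    have cx : y @[y --> x^'+] --> x by exact: cvg_at_right_filter.
    apply: cvgD; first by apply: cvgD; [exact: cx|exact: cvg_cst].
    by apply: cvg_norm; apply: cvgB; [exact: cx|exact: cvg_cst].
  by apply: cvgB; [exact: cvgD|apply: cvg_norm; exact: cvgB].
- rewrite tail_lt0// min_l ?subrr// /c max_r ?divff ?gt_eqF//.
  by rewrite (le_trans (ltW x0))// ltW.
- by rewrite tail_ge1// min_l ?subr0// divr_ge0// ltW.
exists P => // x; rewrite in_itv/= => /andP[x0 x1].
have -> : tail P x = Num.min (tail P0 x) (c x) by rewrite PE opprB addrC subrK.
have t0 := tail_ge0 P0 x; have t1 := tail_le1 P0 x.
have [xpi|pix] := leP x pi.
  have -> : c x = 1 by rewrite /c max_r ?divff ?gt_eqF.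
  rewrite min_l// subrr normr0; split; last by rewrite le_max lexx orbT.
  by rewrite (le_trans _ xpi)// ler_piMr.
have xgt0 : 0 < x by exact: lt_trans pix.
have cE : c x = pi / x by rewrite /c max_l// ltW.
split.
  rewrite (@le_trans _ _ (x * c x))// ?ler_wpM2l// ?ge_min ?lexx ?orbT//.
  by rewrite cE mulrC divfK// gt_eqF.
rewrite cE; have [?|?] := leP (tail P0 x) (pi / x).
  by rewrite subrr normr0 le_max lexx orbT.
by rewrite distrC gtr0_norm ?subr_gt0// le_max lexx.
Qed.

End capped_law.

(** * The expected payment is at most the best posted revenue *)

Section revenue_bound.
Context {R : realType} (q m : R -> R).
Hypothesis qm : mechanism q m.
Let mu := @lebesgue_measure R.

Let q_nd x y : 0 <= x -> x <= y -> y <= 1 -> q x <= q y.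
Proof.
have [_ nd _] := qm => x0 xy y1; apply: nd => //; rewrite in_itv/=; lra.
Qed.

Let q_01 v : 0 <= v <= 1 -> 0 <= q v <= 1.
Proof.
by have [q01 _ _] := qm => v01; have := q01 v; rewrite !in_itv/=; exact.
Qed.

Let mE v : 0 <= v <= 1 -> m v = v * q v - \int[mu]_(x in `[0, v]) q x.
Proof.
have [_ nd rs] := qm => /andP[v0 v1]; apply/rs_integral_idE => //.
  by move=> x y; rewrite !in_itv/= => ? ?; apply: nd; rewrite in_itv/=; lra.
by apply: rs; rewrite in_itv/= v0.
Qed.

(** Between x and y the payment is the integral of a value in [x, y] against
    dq. *)
Lemma payment_increment x y : 0 <= x -> x <= y -> y <= 1 ->
  0 <= m y - m x <= y * (q y - q x).
Proof.
move=> x0 xy y1; rewrite !mE; [|lra..].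
have nd a b : 0 <= a -> b <= 1 -> {in `[a, b] &, {homo q : x y / x <= y}}.
  move=> a0 b1 u v; rewrite !in_itv/= => ? ? uv; apply: q_nd => //; lra.
have /andP[lo hi] := Rintegral_nd_bounds xy (nd _ _ x0 y1).
have I0y : mu.-integrable `[0, y] (EFin \o q).
  by apply: integrable_nd; exact: nd.
have := @Rintegral_itvB R q (BLeft 0) (BRight y) x I0y.
rewrite !bnd_simp => /(_ x0 xy).
have -> : \int[mu]_(u in `]x, y]) q u = \int[mu]_(u in `[x, y]) q u.
  apply: Rintegral_itv_obnd_cbnd; apply: (integrableS _ _ _ I0y) => //.
  by apply: subset_itvr; rewrite bnd_simp.
have := q_nd x0 xy y1; move: lo hi; rewrite -/mu.
set I1 := \int[mu]_(_ in _) _; set I2 := \int[mu]_(_ in _) _.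
set I3 := \int[mu]_(_ in _) _; move=> lo hi qxy E.
have ? : 0 <= x * (q y - q x) by rewrite mulr_ge0// subr_ge0.
by apply/andP; split; lra.
Qed.

Lemma payment0 : m 0 = 0.
Proof. by rewrite mE ?lexx ?ler01// mul0r set_itv1 Rintegral_set1 subrr. Qed.

Variable n : nat.
Let x_ (i : nat) : R := i%:R / n.+1%:R.
Let a_ i := x_ i.+1 * (q (x_ i.+1) - q (x_ i)).

Let x_lt i j : (i < j)%N -> x_ i < x_ j.
Proof. by move=> ij; rewrite ltr_pM2r ?ltr_nat ?invr_gt0. Qed.

Let x_01 i : (i <= n.+1)%N -> 0 <= x_ i <= 1.
Proof.
by move=> ij; rewrite divr_ge0//= ler_pdivrMr// mul1r ler_nat.
Qed.

Let a_ge0 i : (i <= n)%N -> 0 <= a_ i.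
Proof.
move=> i_n; have /andP[? _] : 0 <= x_ i <= 1 by apply: x_01; exact: ltnW.
have /andP[? ?] := @x_01 i.+1 i_n.
by rewrite mulr_ge0// subr_ge0 q_nd// ltW// x_lt.
Qed.

(** An upper Riemann-Stieltjes sum for the payment: each cell of the grid counts
    as soon as v lies above its left end, and is weighted by its right end. *)
Lemma payment_le_sum j v : (j <= n.+1)%N -> 0 <= v <= x_ j ->
  m v <= \sum_(0 <= i < j) a_ i * \1_(`]x_ i, +oo[) v.
Proof.
elim: j v => [v _|j IH v jn].
  rewrite /x_ mul0r => v0; have -> : v = 0 by lra.
  by rewrite payment0 big_nil.
move=> /andP[v0 vj]; rewrite big_nat_recr//=.
have := x_01 jn; have := x_01 (ltnW jn) => /andP[xj0 _] /andP[_ xj1].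
have aj := @a_ge0 j jn.
have [vx|xv] := leP v (x_ j).
  by apply: ler_wpDr; [rewrite mulr_ge0|apply: IH; rewrite ?v0//; exact: ltnW].
rewrite [X in _ + _ * X]indicE mem_set ?mulr1/=; last by rewrite in_itv/= xv.
have /andP[_ mv] : 0 <= m v - m (x_ j) <= v * (q v - q (x_ j)).
  by apply: payment_increment => //; lra.
have mxj : m (x_ j) <= \sum_(0 <= i < j) a_ i * \1_(`]x_ i, +oo[) v.
  rewrite (le_trans (IH (x_ j) (ltnW jn) _)) ?xj0 ?lexx//.
  apply: ler_sum_nat => i /andP[_ ij].
  rewrite ler_wpM2l ?a_ge0//; first by rewrite (leq_trans (ltnW ij)).
  rewrite !indicE !mem_set//= in_itv/= andbT ?x_lt//.
  exact: lt_trans (x_lt ij) xv.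
have : v * (q v - q (x_ j)) <= a_ j.
  have ? : 0 <= q v - q (x_ j) by rewrite subr_ge0 q_nd//; lra.
  apply: ler_pM => //; rewrite lerD2r q_nd//.
lra.
Qed.

Variable P : probability (measurableTypeR R) R.

Let integral_steps j : P.-integrable `[0, 1]
    (EFin \o (fun v => \sum_(0 <= i < j) a_ i * \1_(`]x_ i, +oo[) v)) /\
  \int[P]_(v in `[0, 1]) (\sum_(0 <= i < j) a_ i * \1_(`]x_ i, +oo[) v) =
  \sum_(0 <= i < j) a_ i * fine (P (`]x_ i, +oo[ `&` `[0, 1])).
Proof.
have ind i : P.-integrable `[0, 1] (EFin \o (\1_(`]x_ i, +oo[) : R -> R)).
  by apply: (integrableS measurableT) => //; exact: integrable_indic.
have aind i : P.-integrable `[0, 1]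
    (EFin \o (fun v => a_ i * (\1_(`]x_ i, +oo[) v : R))).
  exact: integrable_EFinZl.
pose S k (v : R) := \sum_(0 <= i < k) a_ i * \1_(`]x_ i, +oo[) v.
have S0 : S 0%N = cst 0 by apply/funext => v; rewrite /S big_geq.
have SS k : S k.+1 = fun v => S k v + a_ k * \1_(`]x_ k, +oo[) v.
  by apply/funext => v; rewrite /S big_nat_recr.
rewrite -/(S j); elim: j => [|j [IH1 IH2]].
  rewrite S0 big_geq// Rintegral_cst// mul0r; split => //.
  exact: integrable0.
rewrite SS big_nat_recr//=; split; first exact: integrable_EFinD.
rewrite RintegralD// IH2 RintegralZl//; congr (_ + _ * _).
by rewrite /Rintegral integral_indic.
Qed.

Variable pi : R.
Hypothesis pi0 : 0 <= pi.
Hypothesis Ppi : forall x, x \in `[0, 1] -> x * tail P x <= pi.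

Lemma payment_integrable : P.-integrable `[0, 1] (EFin \o m).
Proof.
have m_nd x y : 0 <= x -> x <= y -> y <= 1 -> m x <= m y.
  move=> x0 xy y1; have /andP[] := payment_increment x0 xy y1.
  by rewrite subr_ge0.
apply: (@bounded_integrable _ _ _ P _ _ (m 1)) => //.
- by rewrite -ge0_fin_numE// fin_num_measure.
- have : mu.-integrable `[0, 1] (EFin \o m).
    apply: integrable_nd => x y; rewrite !in_itv/= => /andP[x0 _] /andP[_ y1].
    by move=> xy; exact: m_nd.
  by move=> /measurable_int/measurable_EFinP.
- move=> x /=; rewrite in_itv/= => /andP[x0 x1].
  by rewrite ger0_norm -1?payment0 m_nd.
Qed.

(** Integrating the upper sum turns the indicators into tails.  The weight of a
    cell is its right end, hence exceeds the price whose revenue is bounded by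
    pi by one grid step: this is the extra term. *)
Lemma expected_revenue_le_grid : expected_revenue P m <= pi + n.+1%:R^-1.
Proof.
have [istep Estep] := integral_steps n.+1.
apply: (@le_trans _ _ (\int[P]_(v in `[0, 1])
    (\sum_(0 <= i < n.+1) a_ i * \1_(`]x_ i, +oo[) v))).
  apply: le_Rintegral => // [|v]; first exact: payment_integrable.
  rewrite /= in_itv/= => v01; apply: payment_le_sum => //.
  by rewrite /x_ divff.
rewrite Estep.
have pin0 : 0 <= pi + n.+1%:R^-1 by rewrite addr_ge0.
apply: (@le_trans _ _ (\sum_(0 <= i < n.+1)
    (pi + n.+1%:R^-1) * (q (x_ i.+1) - q (x_ i)))).
  apply: ler_sum_nat => i /andP[_ i_n]; rewrite /a_ mulrAC.
  have /andP[xi0 xi1] := x_01 (ltnW i_n).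
  have /andP[_ xSi1] := @x_01 i.+1 i_n.
  rewrite ler_wpM2r// ?subr_ge0 ?q_nd// ?(ltW (x_lt _))//.
  apply: (@le_trans _ _ (x_ i.+1 * tail P (x_ i))).
    rewrite ler_wpM2l//; first by rewrite (le_trans xi0)// ltW// x_lt.
    rewrite tailE fine_le ?fin_num_measure//; first exact: measurableI.
    by rewrite le_measure ?inE//; exact: measurableI.
  have -> : x_ i.+1 = x_ i + n.+1%:R^-1.
    by rewrite /x_ -[in LHS]natr1 mulrDl mul1r.
  rewrite mulrDl lerD ?Ppi ?in_itv/= ?xi0//.
  by rewrite ler_piMr// tail_le1.
rewrite -mulr_sumr (telescope_sumr (fun i => q (x_ i)))//.
have /andP[? _] : 0 <= q (x_ 0%N) <= 1 by apply: q_01; exact: x_01.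
have /andP[_ ?] : 0 <= q (x_ n.+1) <= 1 by apply: q_01; exact: x_01.
by rewrite ler_piMr//; lra.
Qed.

End revenue_bound.

Lemma expected_revenue_le (R : realType) (q m : R -> R)
    (P : probability (measurableTypeR R) R) (pi : R) :
  mechanism q m -> 0 <= pi ->
  (forall x, x \in `[0, 1] -> x * tail P x <= pi) -> expected_revenue P m <= pi.
Proof.
move=> qm pi0 Ppi; apply/ler_addgt0Pr => e e0.
have [n _ /(_ n (leqnn n)) ne] := near_infty_natSinv_lt (PosNum e0).
apply: le_trans (expected_revenue_le_grid qm n pi0 Ppi) _.
by rewrite lerD2l ltW.
Qed.

(** * The first-order condition of the reduced problem *)

Lemma excess_integrable (R : realType) (P : probability (measurableTypeR R) R)
    (s : R) : 0 <= s ->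
  (@lebesgue_measure R).-integrable `[0, 1]
    (EFin \o (fun x => Num.max (tail P x - s / x) 0)).
Proof.
move=> s0.
apply: (@bounded_integrable _ _ _ lebesgue_measure _ _ 1) => // [||x].
- exact: lebesgue_unit_fin.
- apply: measurable_maxr => //; apply: measurable_funB.
    exact: measurable_tail.
  by apply: measurable_funM => //; exact: measurable_inv.
- rewrite /= in_itv/= => /andP[x0 x1]; rewrite ger0_norm ?le_max ?lexx ?orbT//.
  rewrite ge_max ler01 andbT (le_trans _ (tail_le1 P x))// gerBl.
  by rewrite divr_ge0.
Qed.

Lemma wasserstein_integrable (R : realType)
    (P Q : probability (measurableTypeR R) R) :
  (@lebesgue_measure R).-integrable `[0, 1]
    (EFin \o (fun x => `|tail P x - tail Q x|)).
Proof.
apply: (@bounded_integrable _ _ _ lebesgue_measure _ _ 1) => // [||x _].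
- exact: lebesgue_unit_fin.
- apply: measurableT_comp => //.
  by apply: measurable_funB; exact: measurable_tail.
- rewrite normr_id ler_norml; have := tail_ge0 P x; have := tail_le1 P x.
  have := tail_ge0 Q x; have := tail_le1 Q x; lra.
Qed.

Section revenue_distance.
Context {R : realType} (P0 : probability (measurableTypeR R) R).
Let mu := @lebesgue_measure R.
Let t := tail P0.
Let d := revenue_distance P0.

Let ge_ind (s x : R) : R := (s / x <= t x)%R%:R.
Let gt_ind (s x : R) : R := (s / x < t x)%R%:R.

Implicit Types (s x : R).

Let mu01 := lebesgue_unit_fin R.

Let measurable_div s : measurable_fun setT (fun x : R => s / x).
Proof. by apply: measurable_funM => //; exact: measurable_inv. Qed.

Let measurable_ge_ind s : measurable_fun setT (ge_ind s).
Proof.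
rewrite (_ : ge_ind s = fun x => if s / x <= t x then 1 else 0).
  apply: measurable_fun_ifT => //; apply: measurable_fun_ler => //.
  exact: measurable_tail.
by apply/funext => x; rewrite /ge_ind; case: ifP.
Qed.

Let measurable_gt_ind s : measurable_fun setT (gt_ind s).
Proof.
rewrite (_ : gt_ind s = fun x => if s / x < t x then 1 else 0).
  apply: measurable_fun_ifT => //; apply: measurable_fun_ltr => //.
  exact: measurable_tail.
by apply/funext => x; rewrite /gt_ind; case: ifP.
Qed.

Let ge_ind01 s x : 0 <= ge_ind s x <= 1.
Proof. by rewrite /ge_ind ler0n lern1 leq_b1. Qed.

Let gt_ind01 s x : 0 <= gt_ind s x <= 1.
Proof. by rewrite /gt_ind ler0n lern1 leq_b1. Qed.

(** Tails being at most 1, the level s / x is reached only for x >= s; this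
    keeps the singularity of 1 / x away. *)
Let density_bounded s x : 0 < s -> 0 <= x -> 0 <= ge_ind s x * x^-1 <= s^-1.
Proof.
move=> s0; rewrite le_eqVlt => /predU1P[<-|x0].
  by rewrite invr0 mulr0 lexx invr_ge0 ltW.
rewrite mulr_ge0 ?invr_ge0 ?(ltW x0)//=.
rewrite /ge_ind.
case: (leP (s / x)) => [sxt|_]; last by rewrite mul0r invr_ge0 ltW.
have : s / x <= 1 by exact: le_trans sxt (tail_le1 _ _).
by rewrite mul1r ler_pdivrMr// mul1r lef_pV2.
Qed.

Let density_integrable s : 0 < s ->
  mu.-integrable `[0, 1] (EFin \o (fun x => ge_ind s x * x^-1)).
Proof.
move=> s0; apply: (@bounded_integrable _ _ _ mu _ _ s^-1) => // [|x].
  apply: measurable_funM; last exact: measurable_inv.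
  exact: measurable_funTS (measurable_ge_ind s).
rewrite /= in_itv/= => /andP[x0 _].
by have /andP[? ?] := density_bounded s0 x0; rewrite ger0_norm.
Qed.

Let J s := \int[mu]_(x in `[0, 1]) (ge_ind s x * x^-1).

Lemma revenue_distance_ge0 s : 0 <= d s.
Proof. by apply: Rintegral_ge0 => x _; rewrite le_max lexx orbT. Qed.

(** - J s is a subgradient at s of the convex function d; the inequality already
    holds for the integrands. *)
Let subgradient s (p : R) : 0 < s -> 0 <= p -> d s + (s - p) * J s <= d p.
Proof.
move=> s0 p0; rewrite -RintegralZl//; last exact: density_integrable.
have iJ : mu.-integrable `[0, 1]
    (EFin \o (fun x => (s - p) * (ge_ind s x * x^-1))).
  by apply: integrable_EFinZl => //; exact: density_integrable.
rewrite -RintegralD//; last by apply: excess_integrable; exact: ltW.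
apply: le_Rintegral => //; first 1 last.
- exact: excess_integrable.
- move=> x /=; rewrite in_itv/= => /andP[x0 _].
  have xV : 0 <= x^-1 by rewrite invr_ge0.
  rewrite /ge_ind -/t; have [st|st] := leP (s / x) (t x).
    have -> : Num.max (t x - s / x) 0 = t x - s / x by rewrite max_l// subr_ge0.
    rewrite le_max mul1r; apply/orP; left; lra.
  have -> : Num.max (t x - s / x) 0 = 0 by rewrite max_r// subr_le0 ltW.
  by rewrite mul0r mulr0 addr0 le_max lexx orbT.
apply: integrable_EFinD => //; by apply: excess_integrable; exact: ltW.
Qed.

Let revenue_distance_eq0 s : max_revenue P0 <= s -> d s = 0.
Proof.
move=> ms; rewrite /d /revenue_distance -/mu.
rewrite -Rintegral_itv_obnd_cbnd; last first.
  have s0 := le_trans (max_revenue_ge0 P0) ms.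
  apply: integrableS (excess_integrable P0 s0) => //.
  by apply: subset_itvr; rewrite bnd_simp.
rewrite (@eq_Rintegral _ _ _ mu _ (cst 0)) ?Rintegral_cst ?mul0r// => x.
rewrite inE/= in_itv/= => /andP[x0 x1].
rewrite max_r// subr_le0 ler_pdivlMr// mulrC.
apply: le_trans (tail_le_posted _ (ltW x0)) (le_trans _ ms).
by apply: posted_revenue_le_max; rewrite in_itv/= (ltW x0).
Qed.

Variables (k p : R).
Hypothesis k0 : 0 < k.
Hypothesis p01 : p \in `[0, max_revenue P0].
Hypothesis pmin : forall s, s \in `[0, max_revenue P0] ->
  reduced_objective P0 k p <= reduced_objective P0 k s.

Let p0 : 0 <= p. Proof. by move: p01; rewrite in_itv/= => /andP[]. Qed.

(** Beyond max_revenue the distance is 0 and the objective is increasing, so p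
    is a minimiser over the whole half-line: it can be increased even if it
    equals max_revenue. *)
Let pmin_ge0 s : 0 <= s -> p + k * d p <= s + k * d s.
Proof.
move=> s0; have [sM|Ms] := leP s (max_revenue P0).
  by apply: pmin; rewrite in_itv/= s0.
have := @pmin (max_revenue P0); rewrite in_itv/= max_revenue_ge0 lexx.
move=> /(_ isT).
rewrite /reduced_objective -/(d (max_revenue P0)) -/(d p).
rewrite (revenue_distance_eq0 (lexx _)) mulr0 addr0 => /le_trans; apply.
by rewrite (le_trans (ltW Ms))// lerDl mulr_ge0 ?revenue_distance_ge0// ltW.
Qed.

Let mass_le1 s : p < s -> k * J s <= 1.
Proof.
move=> ps; have s0 : 0 < s by exact: le_lt_trans ps.
have h : k * (d s + (s - p) * J s) <= k * d p.
  by rewrite ler_pM2l//; exact: subgradient.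
have := pmin_ge0 (ltW s0) => h2.
rewrite -(@ler_pM2l _ (s - p)) ?subr_gt0// mulr1 mulrCA; lra.
Qed.

Let mass_ge1 s : 0 < s -> s < p -> 1 <= k * J s.
Proof.
move=> s0 sp.
have h : k * (d s + (s - p) * J s) <= k * d p.
  by rewrite ler_pM2l//; exact: subgradient.
have := pmin_ge0 (ltW s0) => h2.
rewrite -(@ler_pM2l _ (p - s)) ?subr_gt0// mulr1 mulrCA; lra.
Qed.

Let J_EFin s : 0 < s ->
  (\int[mu]_(x in `[0%R, 1%R]) (ge_ind s x * x^-1)%:E)%E = (J s)%:E.
Proof.
move=> s0; rewrite /J /Rintegral fineK//.
by apply: integrable_fin_num => //; exact: density_integrable.
Qed.

Let D0 x : x \in `[0, 1]%classic -> 0 <= x.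
Proof. by rewrite inE/= in_itv/= => /andP[]. Qed.

Let ge_ind_ni s s' x : 0 <= x -> s <= s' ->
  ge_ind s' x * x^-1 <= ge_ind s x * x^-1.
Proof.
move=> x0 ss; rewrite ler_wpM2r ?invr_ge0// /ge_ind ler_nat.
have [st|//] := leP (s' / x) (t x); rewrite (le_trans _ st)//.
by rewrite ler_wpM2r ?invr_ge0.
Qed.

Let density_ge0 s x : 0 <= x -> 0 <= ge_ind s x * x^-1.
Proof. by move=> x0; rewrite mulr_ge0 ?invr_ge0// ler0n. Qed.

Let cvg_div (s : R^nat) x : s n @[n --> \oo] --> p ->
  s n / x @[n --> \oo] --> p / x.
Proof. by move=> sp; apply: cvgM => //; exact: cvg_cst. Qed.

Let measurable_density (w : R -> R) : measurable_fun setT w ->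
  measurable_fun (`[0, 1]%classic : set R) (fun x => (w x * x^-1)%:E).
Proof.
move=> mw; apply/measurable_EFinP; apply: measurable_funM.
  exact: measurable_funTS mw.
exact: measurable_inv.
Qed.

(** [mass_le1] as s decreases to p.  The limit is taken by monotone
    convergence, which needs no bound on 1 / x and so covers p = 0. *)
Let strict_density_le :
  (\int[mu]_(x in `[0%R, 1%R]) (gt_ind p x * x^-1)%:E <= (k^-1)%:E)%E.
Proof.
pose s n : R := p + n.+1%:R^-1.
have ps n : p < s n by rewrite ltrDl.
have s0 n : 0 < s n by exact: le_lt_trans (ps n).
have s_ni i j : (i <= j)%N -> s j <= s i.
  by move=> ij; rewrite lerD2l lef_pV2 ?posrE// ler_nat.
have sp : s n @[n --> \oo] --> p.
  rewrite -[X in _ --> X]addr0; apply: cvgD; first exact: cvg_cst.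
  exact: cvg_harmonic.
have wlim x : x \in `[0, 1]%classic ->
    (ge_ind (s n) x * x^-1)%:E @[n --> \oo] --> (gt_ind p x * x^-1)%:E.
  move=> /D0; rewrite le_eqVlt => /predU1P[<-|x0].
    by rewrite invr0 mulr0; under eq_fun do rewrite mulr0; exact: cvg_cst.
  apply: cvg_near_cst; rewrite /gt_ind.
  have [pt|tp] := ltP (p / x) (t x); near=> n; rewrite /ge_ind.
    suff -> : s n / x <= t x by [].
    apply/ltW; near: n; exact: (cvgr_lt (p / x) (cvg_div sp)).
  by rewrite leNgt (le_lt_trans tp)// ltr_pM2r ?invr_gt0.
under eq_integral => x x01 do rewrite -(cvg_lim _ (wlim x x01))//.
rewrite monotone_convergence//.
- apply: lime_le.
    apply: ereal_nondecreasing_is_cvgn => i j ij; apply: ge0_le_integral => //.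
    + by move=> x /mem_set/D0 x0; rewrite lee_fin density_ge0.
    + exact: measurable_density.
    + exact: measurable_density.
    + by move=> x /mem_set/D0 x0; rewrite lee_fin ge_ind_ni// s_ni.
  apply: nearW => n; rewrite J_EFin// lee_fin -[k^-1]mulr1 ler_pdivlMl//.
  exact: mass_le1.
- by move=> n; exact: measurable_density.
- by move=> n x /mem_set/D0 x0; rewrite lee_fin density_ge0.
- by move=> x /mem_set/D0 x0 i j ij; rewrite lee_fin ge_ind_ni// s_ni.
Unshelve. all: by end_near. Qed.

(** [mass_ge1] as s increases to p, staying above p / 2 so that 2 / p dominates
    the integrands. *)
Let weak_density_ge : 0 < p -> 1 <= k * J p.
Proof.
move=> pgt0; pose s n : R := p - p / 2 * n.+1%:R^-1.
have p2 : 0 < p / 2 by rewrite divr_gt0.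
have sltp n : s n < p by rewrite /s ltrBlDr ltrDl mulr_gt0.
have sge n : p / 2 <= s n.
  rewrite /s lerBrDr {3}(splitr p) lerD2l ger_pMr// invf_le1//.
  by rewrite ler1n.
have s0 n : 0 < s n by exact: lt_le_trans (sge n).
have sp : s n @[n --> \oo] --> p.
  rewrite -[X in _ --> X]subr0; apply: cvgB; first exact: cvg_cst.
  rewrite -[X in _ --> X](mulr0 (p / 2)).
  by apply: cvgM; [exact: cvg_cst|exact: cvg_harmonic].
have wlim x : x \in `[0, 1]%classic ->
    (ge_ind (s n) x * x^-1)%:E @[n --> \oo] --> (ge_ind p x * x^-1)%:E.
  move=> /D0; rewrite le_eqVlt => /predU1P[<-|x0].
    by rewrite invr0 mulr0; under eq_fun do rewrite mulr0; exact: cvg_cst.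
  (* The indicators are eventually constant at every point. *)
  apply: cvg_near_cst.
  have [pt|tp] := leP (p / x) (t x); near=> n; rewrite /ge_ind.
    by rewrite pt (le_trans _ pt)// ler_pM2r ?invr_gt0// ltW.
  rewrite [p / x <= _]leNgt tp.
  suff : t x < s n / x by rewrite ltNge => /negbTE ->.
  near: n; exact: (cvgr_gt (p / x) (cvg_div sp)).
have [|||||_ _ dom] := @dominated_convergence _ _ _ mu `[0, 1]%classic
    (measurable_itv _) (fun n x => (ge_ind (s n) x * x^-1)%:E)
    (fun x => (ge_ind p x * x^-1)%:E) (EFin \o cst (p / 2)^-1).
- by move=> n; exact: measurable_density.
- exact: measurable_density.
- by apply: aeW => x /mem_set; exact: wlim.
- apply: (@bounded_integrable _ _ _ mu _ _ (p / 2)^-1) => // x _.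
  by rewrite ger0_norm// invr_ge0 ltW.
- apply: aeW => x n /mem_set/D0 x0; rewrite /= lee_fin ger0_norm ?density_ge0//.
  have /andP[_] := density_bounded (s0 n) x0; move/le_trans; apply.
  by rewrite lef_pV2 ?posrE.
move: dom; rewrite J_EFin// => dom.
have : ((k^-1)%:E <= (J p)%:E)%E.
  rewrite -(cvg_lim _ dom)//; apply: lime_ge.
    by apply/cvg_ex; exists (J p)%:E.
  apply: nearW => n; rewrite /= J_EFin// lee_fin -[k^-1]mulr1 ler_pdivrMl//.
  exact: mass_ge1.
by rewrite lee_fin -[k^-1]mulr1 ler_pdivrMl.
Unshelve. all: by end_near. Qed.

(** At p the left derivative of the objective is at most 0 and the right one at
    least 0; w interpolates between the indicators that compute them so as to
    make the derivative vanish.  If p = 0 only the right derivative is at hand,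
    and the product with p makes up for it. *)
Lemma optimal_density : exists w : R -> R,
  [/\ measurable_fun setT w, forall x, 0 <= w x <= 1,
      mu.-integrable `[0, 1] (EFin \o (fun x => w x * x^-1)) &
      [/\ k * \int[mu]_(x in `[0, 1]) (w x * x^-1) <= 1,
      p * (1 - k * \int[mu]_(x in `[0, 1]) (w x * x^-1)) = 0 &
      forall x, w x * (tail P0 x - p / x) = Num.max (tail P0 x - p / x) 0]].
Proof.
have io : mu.-integrable `[0, 1] (EFin \o (fun x => gt_ind p x * x^-1)).
  apply/integrableP; split; first exact: measurable_density.
  under eq_integral => x /D0 x0.
    rewrite /= ger0_norm; last by rewrite mulr_ge0 ?invr_ge0// ler0n.
    over.
  exact: le_lt_trans strict_density_le (ltry _).
set Jo := \int[mu]_(x in `[0, 1]) (gt_ind p x * x^-1).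
have Jo1 : k * Jo <= 1.
  have : (Jo%:E <= (k^-1)%:E)%E.
    rewrite /Jo /Rintegral fineK; first exact: strict_density_le.
    exact: integrable_fin_num.
  by rewrite lee_fin -[k^-1]mulr1 ler_pdivlMl.
have gt_indE x : gt_ind p x * (t x - p / x) = Num.max (t x - p / x) 0.
  rewrite /gt_ind; have [pt|tp] := ltP (p / x) (t x).
    by rewrite mul1r max_l// subr_ge0 ltW.
  by rewrite mul0r max_r// subr_le0.
have ge_indE x : ge_ind p x * (t x - p / x) = Num.max (t x - p / x) 0.
  rewrite /ge_ind; have [pt|tp] := leP (p / x) (t x).
    by rewrite mul1r max_l// subr_ge0.
  by rewrite mul0r max_r// subr_le0 ltW.
have [p_0|pn0] := eqVneq p 0.
  exists (gt_ind p); split => //; split => //; by rewrite p_0 mul0r.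
have pgt0 : 0 < p by rewrite lt_neqAle eq_sym pn0.
have Jc1 := weak_density_ge pgt0.
have [th [th01 thE]] : exists th, 0 <= th <= 1 /\
    (1 - th) * (k * Jo) + th * (k * J p) = 1.
  have [kJ|kJ] := eqVneq (k * Jo) (k * J p).
    exists 0; split; lra.
  have kJlt : 0 < k * J p - k * Jo by rewrite subr_gt0 lt_neqAle kJ; lra.
  exists ((1 - k * Jo) / (k * J p - k * Jo)); split.
    rewrite divr_ge0 ?subr_ge0//; last by rewrite -subr_ge0 ltW.
    by rewrite ler_pdivrMr// mul1r lerB.
  by field; rewrite gt_eqF.
pose w x := (1 - th) * gt_ind p x + th * ge_ind p x.
have iw1 : mu.-integrable `[0, 1]
    (EFin \o (fun x => (1 - th) * (gt_ind p x * x^-1))).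
  exact: integrable_EFinZl.
have iw2 : mu.-integrable `[0, 1]
    (EFin \o (fun x => th * (ge_ind p x * x^-1))).
  by apply: integrable_EFinZl => //; exact: density_integrable.
have wE : (fun x => w x * x^-1) =
    (fun x => (1 - th) * (gt_ind p x * x^-1) + th * (ge_ind p x * x^-1)).
  by apply/funext => x; rewrite /w mulrDl -!mulrA.
have iE : k * \int[mu]_(x in `[0, 1]) (w x * x^-1) = 1.
  rewrite wE RintegralD// !RintegralZl//; last exact: density_integrable.
  by rewrite -/(J p) -/Jo; apply: etrans thE; ring.
exists w; split.
- by apply: measurable_funD; apply: measurable_funM => //.
- move=> x; have := gt_ind01 p x; have := ge_ind01 p x; rewrite /w.
  move: th01 => /andP[t0 t1] /andP[c0 c1] /andP[v0 v1]; apply/andP; split; nra.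
- by rewrite wE; exact: integrable_EFinD.
- split; rewrite ?iE ?subrr ?mulr0// => x.
  by rewrite /w mulrDl -!mulrA gt_indE ge_indE -mulrDl subrK mul1r.
Qed.

End revenue_distance.

(** * Mechanisms whose allocation has a density *)

Section tonelli.
Context {R : realType}.
Variable nu : {sigma_finite_measure set (measurableTypeR R) -> \bar R}.
Let mu := @lebesgue_measure R.
Variables (g : R -> R) (v : R).
Hypothesis mg : measurable_fun setT g.
Hypothesis g0 : forall y, 0 <= y -> 0 <= g y.

Let f (z : measurableTypeR R * measurableTypeR R) : R :=
  if [&& 0 <= z.2, z.2 < z.1 & z.1 <= v] then g z.2 else 0.

Let mf : measurable_fun setT (EFin \o f).
Proof.
apply/measurable_EFinP; apply: measurable_fun_ifT => //.
  apply: measurable_and; first exact: measurable_fun_ler.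
  apply: measurable_and; first exact: measurable_fun_ltr.
  exact: measurable_fun_ler.
exact: measurableT_comp.
Qed.

Let f0 z : (0 <= (EFin \o f) z)%E.
Proof. by rewrite /= lee_fin /f; case: ifP => // /andP[/g0]. Qed.

(** Both iterated integrals range over 0 <= y < x <= v.  With nu the Lebesgue
    measure this integrates by parts, with nu a law it brings in tails. *)
Lemma tonelli_triangle :
  (\int[nu]_(x in `[0%R, v]) \int[mu]_(y in `[0%R, x[) (g y)%:E =
   \int[mu]_(y in `[0%R, v]) ((g y)%:E * nu `]y, v]%classic))%E.
Proof.
have := @fubini_tonelli _ _ _ _ R nu mu (EFin \o f) mf f0.
rewrite /fubini_F /fubini_G => tonelli.
rewrite [LHS]integral_mkcond [RHS]integral_mkcond.
transitivity (\int[nu]_x \int[mu]_y (EFin \o f) (x, y))%E.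
  apply: eq_integral => x _; rewrite patchE; case: ifPn => [|nx].
    rewrite inE/= in_itv/= => /andP[x0 xv]; rewrite integral_mkcond.
    apply: eq_integral => y _; rewrite patchE /f/= xv andbT.
    have [|] := boolP (y \in `[0, x[%classic).
      by rewrite inE/= in_itv/= => ->.
    by rewrite notin_setE/= in_itv/= => /negP/negbTE ->.
  rewrite integral0_eq// => y _; rewrite /f/=; case: ifP => // /and3P[y0 yx xv].
  by move: nx; rewrite notin_setE/= in_itv/= (le_trans y0 (ltW yx)) xv.
rewrite tonelli; apply: eq_integral => y _; rewrite patchE; case: ifPn => [|ny].
  rewrite inE/= in_itv/= => /andP[y0 yv].
  transitivity (\int[nu]_x ((g y)%:E * (\1_(`]y, v]) x)%:E))%E.
    apply: eq_integral => x _; rewrite /= /f/= y0/= indicE.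
    have [|] := boolP (x \in `]y, v]%classic).
      by rewrite inE/= in_itv/= => ->; rewrite mule1.
    by rewrite notin_setE/= in_itv/= => /negP/negbTE ->; rewrite mule0.
  rewrite ge0_integralZl//; last by rewrite lee_fin g0.
    by rewrite integral_indic// setIT.
  apply/measurable_EFinP; exact: measurable_indic.
rewrite integral0_eq// => x _; rewrite /f/=; case: ifP => // /and3P[y0 yx xv].
by move: ny; rewrite notin_setE/= in_itv/= y0 (le_trans (ltW yx) xv).
Qed.

Lemma tonelli_triangle_Rintegral (h : R -> R) :
  mu.-integrable `[0, v] (EFin \o g) ->
  (forall y, 0 <= y -> y <= v -> nu `]y, v]%classic = (h y)%:E) ->
  \int[nu]_(x in `[0, v]) \int[mu]_(y in `[0, x[) g y =
  \int[mu]_(y in `[0, v]) (g y * h y).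
Proof.
move=> ig nuh; congr fine.
transitivity (\int[nu]_(x in `[0%R, v]) \int[mu]_(y in `[0%R, x[) (g y)%:E)%E;
    last first.
  rewrite tonelli_triangle; apply: eq_integral => y.
  by rewrite inE/= in_itv/= => /andP[y0 yv]; rewrite nuh.
apply: eq_integral => x; rewrite inE/= in_itv/= => /andP[x0 xv].
rewrite /Rintegral fineK//; apply: integrable_fin_num => //.
by apply: integrableS ig => //; apply: subset_itvl; rewrite bnd_simp.
Qed.

End tonelli.

Section density_mechanism.
Context {R : realType} (w : R -> R) (k : R).
Let mu := @lebesgue_measure R.
Hypothesis mw : measurable_fun setT w.
Hypothesis w01 : forall x, 0 <= w x <= 1.
Hypothesis iw : mu.-integrable `[0, 1] (EFin \o (fun x => w x * x^-1)).
Hypothesis k0 : 0 < k.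
Hypothesis mass : k * \int[mu]_(x in `[0, 1]) (w x * x^-1) <= 1.

Let g x := k * (w x * x^-1).

(** Allocation with density k * w x / x, and the payment x dq(x) it entails,
    with density k * w x.  The right end is left out so that [tonelli_triangle]
    produces P `]y, 1], which is the tail of P if P is supported on [0, 1]. *)
Definition density_allocation v := \int[mu]_(x in `[0, v[) g x.
Definition density_payment v := \int[mu]_(x in `[0, v[) (k * w x).

Let q := density_allocation.
Let m := density_payment.

Let mg : measurable_fun setT g.
Proof.
apply: measurable_funM => //; apply: measurable_funM => //.
exact: measurable_inv.
Qed.

Let g0 x : 0 <= x -> 0 <= g x.
Proof.
move=> x0; have /andP[wx _] := w01 x.
by rewrite /g !mulr_ge0 ?invr_ge0// ltW.
Qed.

Let ig : mu.-integrable `[0, 1] (EFin \o g).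
Proof. exact: integrable_EFinZl. Qed.

Let ikw : mu.-integrable `[0, 1] (EFin \o (fun x => k * w x)).
Proof.
apply: (@bounded_integrable _ _ _ mu _ _ k) => //.
- exact: lebesgue_unit_fin.
- by apply: measurable_funM => //; exact: measurable_funTS mw.
- move=> x _; have /andP[? ?] := w01 x.
  by rewrite ger0_norm ?mulr_ge0 ?ler_piMr// ltW.
Qed.

Let sub01 (f : R -> R) (a : itv_bound R) : (a <= BRight 1)%O ->
  mu.-integrable `[0, 1] (EFin \o f) ->
  mu.-integrable [set` Interval (BLeft 0) a] (EFin \o f).
Proof. by move=> a1; apply: integrableS => //; exact: subset_itvl. Qed.

Let q_nd x y : x <= y -> y <= 1 -> q x <= q y.
Proof.
move=> xy y1; have iy : mu.-integrable `[0, y[ (EFin \o g).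
  by apply: sub01 ig; rewrite bnd_simp.
apply: fine_le.
- apply: integrable_fin_num => //; apply: integrableS iy => //.
  by apply: subset_itvl; rewrite bnd_simp.
- exact: integrable_fin_num.
- apply: ge0_subset_integral => //.
  + by apply/measurable_EFinP; exact: measurable_funTS mg.
  + by move=> z /=; rewrite in_itv/= lee_fin => /andP[z0 _]; exact: g0.
  + by apply: subset_itvl; rewrite bnd_simp.
Qed.

Let q_ge0 v : 0 <= q v.
Proof. by apply: Rintegral_ge0 => x /=; rewrite in_itv/= => /andP[/g0]. Qed.

Let q_le1 v : v <= 1 -> q v <= 1.
Proof.
move=> v1; apply: le_trans (q_nd v1 (lexx 1)) _.
rewrite /q /density_allocation Rintegral_itv_bndo_bndc; last first.
  by apply: sub01 ig; rewrite bnd_simp.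
by rewrite /g RintegralZl.
Qed.

(** Integration by parts, where the density of the payment is x times that of
    the allocation, except at x = 0. *)
Let q_integral v : 0 <= v -> v <= 1 ->
  m v = v * q v - \int[mu]_(x in `[0, v]) q x.
Proof.
move=> v0 v1.
have igv : mu.-integrable `[0, v] (EFin \o g).
  by apply: sub01 ig; rewrite bnd_simp.
have igy : mu.-integrable `[0, v] (EFin \o (fun y => g y * y)).
  apply: (le_integrable _ _ _ igv) => //.
    apply/measurable_EFinP; apply: measurable_funM => //.
    exact: measurable_funTS mg.
  move=> y /=; rewrite in_itv/= lee_fin => /andP[y0 yv].
  have gy := g0 y0; rewrite !ger0_norm//; last exact: mulr_ge0 gy y0.
  by rewrite ler_piMr// (le_trans yv).
rewrite [X in _ = _ - X](_ : _ = \int[mu]_(y in `[0, v]) (g y * (v - y)));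
    last first.
  apply: (@tonelli_triangle_Rintegral R mu g v mg g0 (fun y => v - y) igv).
  move=> y y0 yv; rewrite /= lebesgue_measure_itv/= lte_fin.
  by case: ltgtP yv => // -> _; rewrite subrr.
rewrite (@eq_Rintegral _ _ _ mu _ (fun y => v * g y - g y * y)); last first.
  by move=> y _; ring.
rewrite RintegralB//; last exact: integrable_EFinZl.
rewrite RintegralZl//.
have -> : \int[mu]_(x in `[0, v]) g x = q v.
  by rewrite -Rintegral_itv_bndo_bndc//; apply: sub01 ig; rewrite bnd_simp.
suff -> : \int[mu]_(x in `[0, v]) (g x * x) = m v by ring.
rewrite -Rintegral_itv_obnd_cbnd; last first.
  by apply: integrableS igy => //; apply: subset_itvr; rewrite bnd_simp.
rewrite (@eq_Rintegral _ _ _ mu _ (fun y => k * w y)); last first.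
  move=> y; rewrite inE/= in_itv/= => /andP[y0 _].
  by rewrite /g -mulrA divfK ?gt_eqF.
rewrite Rintegral_itv_obnd_cbnd; last first.
  apply: integrableS ikw => //.
  by apply: subset_itv; rewrite bnd_simp.
by rewrite -Rintegral_itv_bndo_bndc//; apply: sub01 ikw; rewrite bnd_simp.
Qed.

Lemma density_mechanism : mechanism density_allocation density_payment.
Proof.
split.
- by move=> v; rewrite !in_itv/= => /andP[v0 v1]; rewrite q_ge0 q_le1.
- by move=> x y _; rewrite in_itv/= => /andP[_ y1] xy; exact: q_nd.
- move=> v; rewrite in_itv/= => /andP[v0 v1]; apply/rs_integral_idE => //.
    move=> x y _; rewrite in_itv/= => /andP[_ yv] xy; apply: q_nd => //.
    exact: le_trans v1.
  exact: q_integral.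
Qed.

Lemma density_expected_revenue (P : probability (measurableTypeR R) R) :
  unit_supported P ->
  expected_revenue P density_payment =
    k * \int[mu]_(x in `[0, 1]) (w x * tail P x).
Proof.
move=> P01.
have it : mu.-integrable `[0, 1] (EFin \o (fun x => w x * tail P x)).
  apply: (@bounded_integrable _ _ _ mu _ _ 1) => //.
  - exact: lebesgue_unit_fin.
  - apply: measurable_funM; first exact: measurable_funTS mw.
    exact: measurable_tail.
  - move=> x _; have /andP[wx0 wx1] := w01 x.
    by rewrite ger0_norm ?mulr_ge0 ?mulr_ile1 ?tail_ge0 ?tail_le1.
rewrite /expected_revenue /density_payment.
rewrite (@tonelli_triangle_Rintegral R P (fun x => k * w x) 1 _ _ (tail P))//.
- rewrite -RintegralZl//.
  by apply: eq_Rintegral => x _; rewrite mulrA.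
- exact: measurable_funM.
- by move=> y _; apply: mulr_ge0; [exact: ltW|have /andP[] := w01 y].
- move=> y y0 y1; rewrite tailE fineK ?fin_num_measure//.
  have null1 : P `]1, +oo[%classic = 0%E.
    apply: unit_supported_null => // x /=; rewrite !in_itv/= andbT => x1.
    by apply/negP; rewrite negb_and -!ltNge x1 orbT.
  rewrite [in RHS](@itv_bndbnd_setU _ _ (BRight y) (BRight 1))// measureU//=.
    by rewrite [X in _ = (_ + X)%E]null1 adde0.
  by apply/seteqP; split => x //=; rewrite !in_itv/=; lra.
Qed.

End density_mechanism.

(** * Equivalence of the two problems *)

Section feasibility.
Context {R : realType} (P0 : probability (measurableTypeR R) R).
Hypothesis P0_01 : unit_supported P0.
Variables (tau k : R).
Hypothesis k0 : 0 < k.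
Let mu := @lebesgue_measure R.

Lemma satisficing_reduced (q m : R -> R) :
  mechanism q m -> satisficing_feasible P0 tau q m k ->
  reduced_feasible P0 tau k.
Proof.
move=> qm feas; apply: lb_le_inf.
  exists (reduced_objective P0 k 0), 0 => //=.
  by rewrite in_itv/= lexx max_revenue_ge0.
move=> _ [pi + <-]; rewrite /= in_itv/= => /andP[pi0 _].
have [P P01 Pcap] := exists_capped_law P0_01 pi0.
have Epi : expected_revenue P m <= pi.
  by apply: (expected_revenue_le qm pi0) => x /Pcap[].
have Wd : wasserstein1 P P0 <= revenue_distance P0 pi.
  apply: le_Rintegral => // [||x x01]; last by have [] := Pcap x x01.
  - exact: wasserstein_integrable.
  - exact: excess_integrable.
have := feas P P01; rewrite /reduced_objective.
have : k * wasserstein1 P P0 <= k * revenue_distance P0 pi by rewrite ler_pM2l.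
lra.
Qed.

Lemma reduced_satisficing : reduced_feasible P0 tau k ->
  exists q m : R -> R, mechanism q m /\ satisficing_feasible P0 tau q m k.
Proof.
have [p p01 [pE pmin]] := reduced_objective_min P0 k.
rewrite /reduced_feasible -pE => tau_le.
have [w [mw w01 iw [mass slack wE]]] := optimal_density k0 p01 pmin.
exists (density_allocation w k), (density_payment w k); split.
  exact: density_mechanism.
move=> P P01; rewrite density_expected_revenue//.
have it Q : mu.-integrable `[0, 1] (EFin \o (fun x => w x * tail Q x)).
  apply: (@bounded_integrable _ _ _ mu _ _ 1) => //.
  - exact: lebesgue_unit_fin.
  - apply: measurable_funM; first exact: measurable_funTS mw.
    exact: measurable_tail.
  - move=> x _; have /andP[wx0 wx1] := w01 x.
    by rewrite ger0_norm ?mulr_ge0 ?mulr_ile1 ?tail_ge0 ?tail_le1.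
have iW : mu.-integrable `[0, 1] (EFin \o (fun x => `|tail P x - tail P0 x|)).
  exact: wasserstein_integrable.
(* Moving from P to P0 changes the integral by at most their distance, as w
   takes its values in [0, 1]. *)
have le0 : \int[mu]_(x in `[0, 1]) (w x * tail P0 x) <=
    \int[mu]_(x in `[0, 1]) (w x * tail P x) + wasserstein1 P P0.
  rewrite /wasserstein1 -RintegralD//; apply: le_Rintegral => //.
    exact: integrable_EFinD.
  move=> x _; have /andP[wx0 wx1] := w01 x.
  rewrite -lerBlDl -mulrBr distrC; apply: le_trans (ler_norm _) _.
  by rewrite normrM ger0_norm// ler_piMl.
(* Complementary slackness at p. *)
have obj : k * \int[mu]_(x in `[0, 1]) (w x * tail P0 x) =
    reduced_objective P0 k p.
  have -> : \int[mu]_(x in `[0, 1]) (w x * tail P0 x) =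
      revenue_distance P0 p + p * \int[mu]_(x in `[0, 1]) (w x * x^-1).
    rewrite -RintegralZl// -RintegralD//.
    - by apply: eq_Rintegral => x _; rewrite -wE; ring.
    - by apply: excess_integrable; move: p01; rewrite in_itv/= => /andP[].
    - exact: integrable_EFinZl.
  rewrite /reduced_objective mulrDr [RHS]addrC; congr (_ + _).
  rewrite mulrCA; apply/esym/subr0_eq; apply: etrans slack.
  by rewrite mulrBr mulr1.
rewrite -obj in tau_le; apply: le_trans (lerB tau_le (lexx _)) _.
by rewrite lerBlDl -mulrDr ler_pM2l.
Qed.

End feasibility.

Theorem proposition2 (R : realType) (P0 : probability (measurableTypeR R) R)
    (hP0 : unit_supported P0) (tau : R) (htau : 0 < tau) :
  (forall k : R, 0 < k ->
     (exists q m : R -> R, mechanism q m /\ satisficing_feasible P0 tau q m k) <->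
     reduced_feasible P0 tau k) /\
  ereal_inf [set k%:E | k in [set k : R | 0 < k /\
     exists q m : R -> R, mechanism q m /\ satisficing_feasible P0 tau q m k]] =
  ereal_inf [set k%:E | k in [set k : R | 0 < k /\ reduced_feasible P0 tau k]].
Proof.
have eqv k : 0 < k ->
    (exists q m : R -> R, mechanism q m /\ satisficing_feasible P0 tau q m k) <->
    reduced_feasible P0 tau k.
  move=> k0; split; last exact: reduced_satisficing.
  by move=> [q [m [qm feas]]]; exact: satisficing_reduced qm feas.
split; first exact: eqv.
congr (ereal_inf (EFin @` _)); apply/seteqP; split => k /= [k0 kP]; split => //.
  exact/eqv.
exact/eqv.
Qed.
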